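(* Let $X$ be a Tychonoff space and let $\aleph_\alpha\geq\aleph_1$ be a cardinal. The following statements are equivalent: (1) $C_{\aleph_\alpha}(X)$ is second countable. (2) $C_{\aleph_\alpha}(X)$ is separable. (3) $C_{\aleph_\alpha}(X)$ is Lindelöf and $X$ is $\aleph_\alpha$-separable. (4) $C_{\aleph_\alpha}(X)$ has the Souslin property and $X$ is $\aleph_\alpha$-separable. (5) $C_{\aleph_\alpha}(X)$ has countable spread and $X$ is $\aleph_\alpha$-separable. (6) $C_u(X)$ is separable. (7) $X$ is compact and metrizable.
   Context: Tychonoff means completely regular and Hausdorff. The density of $X$ is $d(X)=\aleph_0+\min\{|D|: D \text{ dense in } X\}$; $X$ is $\aleph_\alpha$-separable if $d(X)<\aleph_\alpha$. A space $Y$ has the Souslin property if every family of pairwise disjoint non-empty open subsets of $Y$ is countable; it has countable spread if every subset of $Y$ that is discrete in the subspace topology is countable. $C(X)$ is the set of all real-valued continuous functions on $X$. For $f\in C(X)$, $A\subseteq X$ and real $\epsilon>0$ put $B(f,A,\epsilon)=\{g\in C(X): \sup_{x\in A}|f(x)-g(x)|<\epsilon\}$ (equal to $C(X)$ when $A=\emptyset$). For an infinite cardinal $\aleph_\alpha$, $C_{\aleph_\alpha}(X)$ is $C(X)$ with the topology having as base all sets $B(f,A,\epsilon)$ with $f\in C(X)$, $\epsilon>0$ and $A\subseteq X$, $|A|<\aleph_\alpha$. $C_u(X)$ is $C(X)$ with the topology of uniform convergence, in which the sets $B(f,X,\epsilon)$, $\epsilon>0$, form a neighborhood base at $f$. 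*)

(* Defs.v *)
From HB Require Import structures.
From mathcomp Require Import all_boot all_order all_algebra.
From mathcomp Require Import all_classical all_reals all_analysis.

Set Implicit Arguments.
Unset Strict Implicit.
Unset Printing Implicit Defensive.

Import Order.TTheory GRing.Theory Num.Theory.
Import numFieldNormedType.Exports.

Local Open Scope classical_set_scope.
Local Open Scope ring_scope.
Local Open Scope card_scope.

Definition card_lt (T U : Type) (A : set T) (B : set U) : Prop :=
  A #<= B /\ ~ (B #<= A).
Notation "A '#<' B" := (card_lt A B) (at level 79) : card_scope.

(* Under choice the infinite cardinals are exactly the alephs; a cardinal is
   represented by a type having that cardinality. *)
Record aleph := Aleph {
  aleph_sort :> Type;
  aleph_infinite : infinite_set [set: aleph_sort] }.

Section cardinal_arithmetic.

Lemma inj_card_leP (T U : Type) (A : set T) (B : set U) (f : T -> U) :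
  (forall x, A x -> B (f x)) ->
  (forall x y, A x -> A y -> f x = f y -> x = y) -> A #<= B.
Proof.
move=> fAB finj.
have /injfunPex[g] : exists2 f : T -> U, set_fun A B f & set_inj A f.
  exists f; first exact: fAB.
  by move=> x y /set_mem Ax /set_mem Ay; exact: finj.
exact: inj_card_le.
Qed.

Lemma card_le_injP (T U : Type) (A : set T) (B : set U) : A #<= B -> U ->
  exists2 f : T -> U, (forall x, A x -> B (f x)) &
    (forall x y, A x -> A y -> f x = f y -> x = y).
Proof.
elim/Ppointed: U => U in B *; first by move=> _ /no.
move=> /pcard_leP[f] _; exists f; first by move=> x Ax; exact: funS.
by move=> x y Ax Ay; apply: inj; rewrite inE.
Qed.

Lemma card_le_total (T U : Type) (A : set T) (B : set U) :
  A #<= B \/ B #<= A.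
Proof.
pose P (G : set (T * U)) := [/\ G `<=` A `*` B,
  (forall x y y', G (x, y) -> G (x, y') -> y = y') &
  (forall x x' y, G (x, y) -> G (x', y) -> x = x')].
have [|G [[GAB Gf Gi] Gmax]] := @Zorn_bigcup _ P.
  move=> F FP Ftot; split.
  - by move=> p [G FG Gp]; have [+ _ _] := FP _ FG; apply.
  - move=> x y y' [G FG Gp] [H FH Hp].
    have [GH|HG] := Ftot _ _ FG FH.
      by have [_ + _] := FP _ FH; apply; [exact: GH Gp|].
    by have [_ + _] := FP _ FG; apply; [exact: Gp|exact: HG].
  - move=> x y y' [G FG Gp] [H FH Hp].
    have [GH|HG] := Ftot _ _ FG FH.
      by have [_ _ +] := FP _ FH; apply; [exact: GH Gp|].
    by have [_ _ +] := FP _ FG; apply; [exact: Gp|exact: HG].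
have [dA|/existsNP[a /not_implyP[Aa /forallNP nGa]]] :=
  pselect (forall x, A x -> exists y, G (x, y)).
  left; have [->|/set0P[x0 Ax0]] := eqVneq A set0; first by rewrite card_ge0.
  have [y0 _] := dA _ Ax0.
  have /choice[f fP] : forall x, exists y, A x -> G (x, y).
    move=> x; have [/dA[y Gy]|nA] := pselect (A x); first by exists y.
    by exists y0.
  apply: (@inj_card_leP _ _ _ _ f) => [x /fP/GAB[]//|x x' /fP Gx /fP Gx' e].
  by apply: Gi Gx _; rewrite e.
have [dB|/existsNP[b /not_implyP[Bb /forallNP nGb]]] :=
  pselect (forall y, B y -> exists x, G (x, y)).
  right; have /choice[f fP] : forall y, exists x, B y -> G (x, y).
    move=> y; have [/dB[x Gx]|nB] := pselect (B y); first by exists x.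
    by exists a.
  apply: (@inj_card_leP _ _ _ _ f) => [x /fP/GAB[]//|y y' /fP Gy /fP Gy' e].
  by apply: Gf Gy _; rewrite e.
exfalso; apply: (Gmax (G `|` [set (a, b)])).
  split; last by move=> /(_ (a, b) (or_intror erefl)); exact: nGa.
  by move=> p Gp; left.
split.
- by move=> p [/GAB//|->].
- move=> x y y' [Gp|[-> ->]] [Gq|].
  + exact: Gf Gp Gq.
  + by case=> xa; move: Gp; rewrite xa => /nGa.
  + by have /nGa := Gq.
  + by case=> ->.
- move=> x y y' [Gp|[-> ->]] [Gq|].
  + exact: Gi Gp Gq.
  + by case=> _ yb; move: Gp; rewrite yb => /nGb.
  + by have /nGb := Gq.
  + by case=> ->.
Qed.

Lemma card_le_setX_bool (T : Type) (B : set T) : infinite_set B ->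
  B `*` [set: bool] #<= B.
Proof.
move=> Binf.
pose D := [set S : set T | [/\ S `<=` B, countable S & infinite_set S]].
have [E [ED tE Emax]] := ex_maximal_disjoint_subcollection id D.
pose Rm := B `\` \bigcup_(S in E) S.
have [t0 Bt0] := infinite_setN0 Binf.
have Rmfin : finite_set Rm.
  apply: contrapT => /infiniteP nR.
  have [f fR fi] := card_le_injP nR t0.
  pose S := range f.
  have SR : S `<=` Rm by move=> _ [n _ <-]; exact: fR.
  have DS : D S.
    split.
    - by move=> x /SR[].
    - exact: card_image_le.
    - apply/infiniteP; apply: (@inj_card_leP _ _ _ _ f) => // n _.
      by exists n.
  have nES : ~ E S.
    move=> ES; have /SR[_] : S (f 0%N) by exists 0%N.
    by apply; exists S => //; exists 0%N.
  apply: (Emax (E `|` [set S])).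
  - split; last by move=> /(_ S (or_intror erefl)).
    by move=> x Ex; left.
  - by move=> x [/ED|->].
  - move=> X Y [EX|->] [EY|->] //.
    + exact: tE.
    + by move=> [x [Xx /SR[_ nE]]]; exfalso; apply: nE; exists X.
    + by move=> [x [/SR[_ nE] Yx]]; exfalso; apply: nE; exists Y.
have [S0 ES0] : E !=set0.
  apply/set0P/eqP => E0; apply: Binf; apply: sub_finite_set Rmfin => x Bx.
  by split=> // -[S]; rewrite E0.
have /choice[s sP] : forall x, exists S, B x -> E S /\ (S `|` Rm) x.
  move=> x; have [[S ES Sx]|nE] := pselect ((\bigcup_(S in E) S) x).
    by exists S => _; split => //; left.
  by exists S0 => Bx; split => //; right.
have /choice[phi phiP] : forall S, exists g : T * bool -> T, E S ->
    (forall p, ((S `|` Rm) `*` [set: bool]) p -> S (g p)) /\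
    (forall p q, ((S `|` Rm) `*` [set: bool]) p ->
       ((S `|` Rm) `*` [set: bool]) q -> g p = g q -> p = q).
  move=> S; have [/ED[SB Sc /infiniteP Si]|nE] := pselect (E S); last first.
    by exists fst.
  have cSR : countable ((S `|` Rm) `*` [set: bool]).
    apply: countableX; last exact: countableP.
    rewrite -bigcup2E; apply: bigcup_countable => // -[|[|n]] _ //=.
    exact: finite_set_countable.
  have [g gS gi] := card_le_injP (card_le_trans cSR Si) t0.
  by exists g.
apply: (@inj_card_leP _ _ _ _ (fun p => phi (s p.1) p)).
  move=> [x b] [/= Bx _]; have [Es sx] := sP _ Bx.
  have [+ _] := phiP _ Es; move=> /(_ (x, b)) h.
  by have [+ _ _] := ED _ Es; apply; apply: h.
move=> [x b] [y c] [/= Bx _] [/= By _] e.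
have [Ex sx] := sP _ Bx; have [Ey sy] := sP _ By.
have [gx ix] := phiP _ Ex; have [gy iy] := phiP _ Ey.
have sxy : s x = s y.
  apply: tE => //; exists (phi (s x) (x, b)); split; first exact: gx.
  by rewrite e; exact: gy.
by apply: ix => //=; [rewrite sxy|rewrite e sxy].
Qed.

Lemma card_setU_le (T : Type) (A B : set T) : infinite_set B -> A #<= B ->
  A `|` B #<= B.
Proof.
move=> Binf AB; have [t0 _] := infinite_setN0 Binf.
have [g gB gi] := card_le_injP AB t0.
apply: card_le_trans (card_le_setX_bool Binf).
pose h x := if x \in B then (x, true) else (g x, false).
apply: (@inj_card_leP _ _ _ _ h) => [x|x y].
  rewrite /h; case: ifPn => [/set_mem//|/negP nB].
  by case=> [Ax|/mem_set//]; split => //=; exact: gB.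
rewrite /h; case: ifPn => [/set_mem Bx|/negP nBx];
  case: ifPn => [/set_mem By|/negP nBy] // ABx ABy [//].
by case: ABx => [Ax|/mem_set//]; case: ABy => [Ay|/mem_set//]; exact: gi.
Qed.

Lemma card_lt_setU (K : aleph) (T : Type) (A B : set T) :
  A #< [set: K] -> B #< [set: K] -> A `|` B #< [set: K].
Proof.
wlog AB : A B / A #<= B.
  move=> h AK BK; have [AB|BA] := card_le_total A B; first exact: h.
  by rewrite setUC; exact: h.
move=> [AK KA] [BK KB].
have [Bfin|Binf] := pselect (finite_set B).
  have Afin : finite_set A by exact: card_le_finite Bfin.
  have Ufin : finite_set (A `|` B) by rewrite finite_setU.
  split; last by move=> /card_le_finite/(_ Ufin)/aleph_infinite.
  have [//|/card_le_finite/(_ Ufin)/aleph_infinite//] :=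
    card_le_total (A `|` B) [set: K].
have UB := card_setU_le Binf AB.
split; first exact: card_le_trans BK.
by move=> KU; apply: KB; exact: card_le_trans UB.
Qed.

Lemma card_lt_set0 (K : aleph) (T : Type) : (@set0 T) #< [set: K].
Proof.
split; first exact: card_ge0.
move=> /card_le_finite /(_ (finite_set0 _)); exact: aleph_infinite.
Qed.

End cardinal_arithmetic.

Section topological_properties.
Context (T : topologicalType).

(* [uniform_separatorP] identifies the separation in [completely_regular_space]
   with separation by a continuous function into [0, 1]. *)
Definition tychonoff_space := completely_regular_space T /\ hausdorff_space T.

Definition separable := exists2 D : set T, countable D & dense D.

Definition lindelof := forall F : set (set T),
  F `<=` open -> \bigcup_(U in F) U = [set: T] ->
  exists G, [/\ G `<=` F, countable G & \bigcup_(U in G) U = [set: T]].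

Definition souslin_property := forall F : set (set T),
  (forall U, F U -> open U /\ U !=set0) ->
  (forall U V, F U -> F V -> U <> V -> U `&` V = set0) -> countable F.

(* [set_type D] carries the subspace topology. *)
Definition countable_spread := forall D : set T,
  (forall B : set (set_type D), open B) -> countable D.

Definition metrizable (R : realType) := exists d : T -> T -> R,
  [/\ forall x y, 0 <= d x y, forall x y, d x y = 0 <-> x = y,
      forall x y, d x y = d y x, forall x y z, d x z <= d x y + d y z
    & forall x, nbhs x =
        filter_from [set e : R | 0 < e] (fun e => [set y | d x y < e])].

Definition min_dense (D : set T) :=
  dense D /\ forall D' : set T, dense D' -> D #<= D'.

(* d(T) < K; the disjoint sum with [nat] is the summand aleph_0 of d(T). *)
Definition aleph_separable (K : aleph) :=
  exists2 D : set T, min_dense D & [set: nat + set_type D] #< [set: K].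

End topological_properties.

Section function_space_balls.
Context (R : realType) (X : topologicalType).
Implicit Types (f g h : continuousType X R) (A : set X) (e : R).

(* The supremum is taken in the extended reals: it is -oo on the empty set and
   +oo when |f - g| is unbounded on A. *)
Definition sup_ball f A e : set (continuousType X R) :=
  [set g | (ereal_sup [set `|f x - g x|%:E | x in A] < e%:E)%E].

Lemma sup_ballP f A e g : sup_ball f A e g <->
  exists2 s, s < e & forall x, A x -> `|f x - g x| <= s.
Proof.
split; rewrite /sup_ball /=; last first.
  move=> [s se fg]; apply: (@le_lt_trans _ _ s%:E); last by rewrite lte_fin.
  by apply: ge_ereal_sup => _ [x Ax <-]; rewrite lee_fin; exact: fg.
have ub x : A x ->
    (`|f x - g x|%:E <= ereal_sup [set `|f x - g x|%:E | x in A])%E.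
  by move=> Ax; apply: ereal_sup_ubound; exists x.
case: (ereal_sup _) ub => [s| |] ub //; rewrite ?lte_fin.
  by move=> se; exists s => // x /ub; rewrite lee_fin.
by move=> _; exists (e - 1); [rewrite ltrBlDr ltrDl|move=> x /ub].
Qed.

Lemma sup_ball_center f A e : 0 < e -> sup_ball f A e f.
Proof.
by move=> e0; apply/sup_ballP; exists 0 => // x _; rewrite subrr normr0.
Qed.

Lemma sup_ball_sub f A e h : sup_ball f A e h ->
  exists2 d, 0 < d & forall A', A `<=` A' -> sup_ball h A' d `<=` sup_ball f A e.
Proof.
move=> /sup_ballP[s se fh]; exists (e - s); first by rewrite subr_gt0.
move=> A' AA' g /sup_ballP[t td hg]; apply/sup_ballP; exists (s + t).
  by rewrite addrC -ltrBrDr.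
move=> x Ax; rewrite (le_trans (ler_distD (h x) _ _)) // lerD //; first exact: fh.
exact/hg/AA'.
Qed.

End function_space_balls.

Definition C_aleph (K : aleph) (R : realType) (X : topologicalType) : Type :=
  continuousType X R.

Section C_aleph_topology.
Context (K : aleph) (R : realType) (X : topologicalType).

Definition C_aleph_base : set (set (C_aleph K R X)) :=
  [set B | exists f A e, [/\ A #< [set: K], 0 < e & B = sup_ball f A e]].

Let C_aleph_cover : \bigcup_(B in C_aleph_base) id B = [set: C_aleph K R X].
Proof.
apply/seteqP; split=> // f _; exists (sup_ball f set0 1); last exact: sup_ball_center.
by exists f, set0, 1; split=> //; exact: card_lt_set0.
Qed.

Let C_aleph_join (B B' : set (C_aleph K R X)) (h : C_aleph K R X) :
  C_aleph_base B -> C_aleph_base B' -> id B h -> id B' h ->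
  exists B'', [/\ C_aleph_base B'', id B'' h & id B'' `<=` id B `&` id B'].
Proof.
move=> [f [A [e [AK e0 ->]]]] [f' [A' [e' [AK' e'0 ->]]]].
move=> /sup_ball_sub[d d0 dP] /sup_ball_sub[d' d'0 d'P].
have m0 : 0 < Num.min d d' by rewrite lt_min d0.
exists (sup_ball h (A `|` A') (Num.min d d')); split.
- by exists h, (A `|` A'), (Num.min d d'); split=> //; exact: card_lt_setU.
- exact: sup_ball_center.
- move=> g /sup_ballP[s]; rewrite lt_min => /andP[sd sd'] hg; split.
    by apply: (dP _ (@subsetUl _ A A')); apply/sup_ballP; exists s.
  by apply: (d'P _ (@subsetUr _ A A')); apply/sup_ballP; exists s.
Qed.

HB.instance Definition _ := Choice.copy (C_aleph K R X) (continuousType X R).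
HB.instance Definition _ :=
  isBaseTopological.Build (C_aleph K R X) C_aleph_cover C_aleph_join.

Lemma C_aleph_basis : basis C_aleph_base.
Proof.
split=> [B BB|f P].
  by exists [set B] => [_ ->//|]; rewrite bigcup_set1.
rewrite nbhsE => -[_ [[D' D'b <-] [B D'B Bf]] BP].
exists B; first by split=> //; exact: D'b.
by move=> g Bg; apply: BP; exists B.
Qed.

End C_aleph_topology.

Definition C_unif (R : realType) (X : topologicalType) : Type :=
  continuousType X R.

HB.instance Definition _ (R : realType) (X : topologicalType) :=
  Topological.copy (C_unif R X)
    (initial_topology (fun f : continuousType X R => (f : {uniform X -> R}))).

Lemma nbhs_C_unif (R : realType) (X : topologicalType) (f : C_unif R X) :
  nbhs f = filter_from [set e : R | 0 < e] (fun e => sup_ball f [set: X] e).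
Proof.
pose i (g : continuousType X R) : {uniform X -> R} := g.
apply/seteqP; split=> P.
  move=> [_ [[W oW <-] Wf WP]].
  have /uniform_nbhs[E [+ EW]] : nbhs (i f) W by exact: open_nbhs_nbhs.
  rewrite -entourage_ballE => -[e /= e0 eE]; exists e => //= g.
  move=> /sup_ballP[s se fg]; apply: WP; apply: EW => x _; apply: eE => /=.
  by rewrite /ball /= (le_lt_trans (fg x I)).
move=> [e /= e0 eP]; apply: (filterS eP).
have ent : entourage [set p : R * R | `|p.1 - p.2| < e / 2].
  by rewrite -entourage_ballE; exists (e / 2) => //=; rewrite divr_gt0.
have nb : nbhs (i f) [set h : {uniform X -> R} | forall x, `|f x - h x| < e / 2].
  apply/uniform_nbhs; exists [set p : R * R | `|p.1 - p.2| < e / 2]; split=> //.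
  by move=> h fh x; exact: fh.
have {nb} : nbhs f (i @^-1` [set h : {uniform X -> R} |
    forall x, `|f x - h x| < e / 2]) by exact: (@initial_continuous _ _ i f).
apply: filterS => g /= fg.
apply/sup_ballP; exists (e / 2); last by move=> x _; exact/ltW/fg.
by rewrite ltr_pdivrMr// mulr_natr mulr2n ltrDl.
Qed.

(* Main.v *)
(* Everything goes through a countable uniformly dense set in C(X). If C(X) has
   one, then X is second countable, since the sets {g < 1/2} with g in the dense
   set form a basis, and every continuous function
   h is bounded, since otherwise the functions a h, a real, would be pairwise at
   infinite distance. A Lindelöf completely regular space on which all continuous
   functions are bounded is compact: a countable cover by cozero sets {g_n > 0}
   gives the positive function sup_n min(1/(n+1), g_n), whose inverse is bounded.
   The same capped supremum of |u_n x - u_n y| is a metric when u_n is uniformly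
   dense.
   If A is dense in X and |A| < K, then B(f, A, e) = B(f, X, e), so the two
   topologies agree and a maximal e-separated subset of C(X) yields disjoint
   balls and is discrete. When C_K(X) is separable, a countable dense set is
   already uniformly dense: otherwise, choosing for each of its members a point
   where it is far from f gives a countable A such that B(f, A, e) misses it. *)
From HB Require Import structures.
Require Import Defs.
From mathcomp Require Import all_boot all_order all_algebra.
From mathcomp Require Import finmap.
From mathcomp Require Import all_classical all_reals all_analysis.
From mathcomp Require Import ring lra.

Import Order.TTheory GRing.Theory Num.Theory.
Import numFieldNormedType.Exports.

Local Open Scope classical_set_scope.
Local Open Scope ring_scope.
Local Open Scope card_scope.

Set Implicit Arguments.
Unset Strict Implicit.
Unset Printing Implicit Defensive.

(** * Consequences of second countability *)

Lemma countable_enum (T : Type) (A : set T) (a : T) : countable A ->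
  exists u : nat -> T, A `<=` range u.
Proof.
move=> /countable_injP[i iinj].
have /choice[u uP] : forall n, exists x, forall y, A y -> i y = n -> x = y.
  move=> n; have [[x [Ax ixn]]|nx] := pselect (exists x, A x /\ i x = n).
    by exists x => y Ay iyn; apply: iinj; rewrite ?inE// ixn iyn.
  by exists a => y Ay iyn; exfalso; apply: nx; exists y.
by exists u => y Ay; exists (i y) => //; exact: uP.
Qed.

Lemma open_basis_sub (T : topologicalType) (B : set (set T)) (x : T) (U : set T) :
  basis B -> open U -> U x -> exists V, [/\ B V, V x & V `<=` U].
Proof.
move=> [_ /(_ x U) BU] oU Ux.
by have [V [BV Vx] VU] := BU (open_nbhs_nbhs (conj oU Ux)); exists V.
Qed.

Lemma second_countable_separable (T : topologicalType) :
  @second_countable T -> separable T.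
Proof.
move=> [B cB Bb].
have [[t _]|nT] := pselect (exists t : T, True); last first.
  by exists set0 => // U [x _]; exfalso; apply: nT; exists x.
have /choice[p pP] : forall V : set T, exists x, V !=set0 -> V x.
  by move=> V; have [[x Vx]|nV] := pselect (V !=set0); [exists x|exists t].
exists (p @` B); first exact: sub_countable (card_image_le _ _) cB.
move=> U [x Ux] oU; have [V [BV Vx VU]] := open_basis_sub Bb oU Ux.
have pV : V (p V) by apply: pP; exists x.
by exists (p V); split; [exact: VU|exists V].
Qed.

Lemma second_countable_lindelof (T : topologicalType) :
  @second_countable T -> lindelof T.
Proof.
move=> [B cB Bb] F Fo Fc.
pose B' := B `&` [set V | exists2 U, F U & V `<=` U].
have /choice[c cP] : forall V, exists U, B' V -> F U /\ V `<=` U.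
  move=> V; have [[BV [U FU VU]]|nV] := pselect (B' V); first by exists U.
  by exists setT.
exists (c @` B'); split.
- by move=> _ [V B'V <-]; have [] := cP _ B'V.
- apply: sub_countable (card_image_le _ _) _.
  by apply: sub_countable cB; apply: subset_card_le => V [].
- apply/seteqP; split=> // x _; have : [set: T] x by [].
  rewrite -Fc => -[U FU Ux].
  have [V [BV Vx VU]] := open_basis_sub Bb (Fo _ FU) Ux.
  have B'V : B' V by split => //; exists U.
  exists (c V); first by exists V.
  by have [_] := cP _ B'V; exact.
Qed.

(** A non-empty basic set chosen inside each member determines that member by disjointness, so the
    family injects into the basis. *)
Lemma second_countable_souslin (T : topologicalType) :
  @second_countable T -> souslin_property T.
Proof.
move=> [B cB Bb] F Fo Fdisj.
have /choice[c cP] : forall U, exists V, F U -> [/\ B V, V !=set0 & V `<=` U].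
  move=> U; have [FU|nFU] := pselect (F U); last by exists setT.
  have [oU [x Ux]] := Fo _ FU.
  have [V [BV Vx VU]] := open_basis_sub Bb oU Ux.
  by exists V => _; split=> //; exists x.
apply: sub_countable cB; apply: (@inj_card_leP _ _ _ _ c) => [U /cP[]//|U U'].
move=> FU FU' cUU'; apply: contrapT => neq.
have [_ [x cx] cU] := cP _ FU; have [_ _ cU'] := cP _ FU'.
suff : set0 x by [].
by rewrite -(Fdisj _ _ FU FU' neq); split; [exact: cU|apply: cU'; rewrite -cUU'].
Qed.

Lemma second_countable_spread (T : topologicalType) :
  @second_countable T -> countable_spread T.
Proof.
move=> [B cB Bb] D Dd.
have /choice[c cP] : forall x, exists V, D x -> [/\ B V, V x & V `&` D `<=` [set x]].
  move=> x; have [Dx|nDx] := pselect (D x); last by exists setT.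
  pose x' : set_type D := SigSub (mem_set Dx).
  have [W oW WD] : open [set x'] by exact: Dd.
  have Wx : W x.
    by have : (set_val @^-1` W) x' by rewrite WD.
  have [V [BV Vx VW]] := open_basis_sub Bb oW Wx.
  exists V => _; split=> // y [Vy Dy].
  pose y' : set_type D := SigSub (mem_set Dy).
  have : (set_val @^-1` W) y' by exact: VW.
  by rewrite WD => /(congr1 val).
apply: sub_countable cB; apply: (@inj_card_leP _ _ _ _ c) => [x /cP[]//|x y].
move=> Dx Dy cxy; have [_ _ cx] := cP _ Dx; have [_ yc _] := cP _ Dy.
by apply/esym/cx; rewrite cxy.
Qed.

(** * Density and cardinals below [K] *)

Lemma countable_card_lt (K : aleph) (T : Type) (A : set T) :
  [set: nat] #< [set: K] -> countable A -> A #< [set: K].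
Proof.
move=> [NK KN] cA; split; first exact: card_le_trans NK.
by move=> KA; apply: KN; exact: card_le_trans cA.
Qed.

(** A countable dense set need not have least cardinality. If some dense set is finite, one of least
    size is taken; otherwise every dense set is infinite and any countable one is minimal. *)
Lemma separable_aleph_separable (T : topologicalType) (K : aleph) :
  [set: nat] #< [set: K] -> separable T -> aleph_separable T K.
Proof.
move=> NK [D cD dD].
have [D' mD' cD'] : exists2 D' : set T, min_dense D' & countable D'.
  have [[n [E dE En]]|nfin] :=
      pselect (exists n, exists2 E : set T, dense E & E #= `I_n).
    pose P n := `[< exists2 E : set T, dense E & E #= `I_n >].
    have exP : exists n, P n by exists n; apply/asboolP; exists E.
    case: (ex_minnP exP) => m /asboolP[E' dE' E'm] mmin; exists E'; last first.
      by apply: finite_set_countable; apply/finite_setP; exists m.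
    split=> // F dF; have [/finite_setP[k Fk]|/infiniteP iF] := pselect (finite_set F).
      have mk : (m <= k)%N by apply: mmin; apply/asboolP; exists F.
      by rewrite (card_le_eql E'm) (card_le_eqr Fk) card_le_II.
    apply: card_le_trans iF; rewrite (card_le_eql E'm).
    exact: subset_card_le.
  exists D => //; split=> // E dE; apply: (card_le_trans cD); apply/infiniteP.
  by move=> /finite_setP[n En]; apply: nfin; exists n, E.
exists D' => //; apply: countable_card_lt => //.
have /countable_injP[i iinj] := cD'.
apply/countable_injP.
(* Even numbers code the summand [nat], odd numbers the points of [D']. *)
exists (fun s => match s with inl n => n.*2 | inr x => (i (val x)).*2.+1 end).
move=> [n|x] [m|y] _ _ /=.
- by move=> /double_inj ->.
- by move=> /(congr1 odd); rewrite /= !odd_double.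
- by move=> /(congr1 odd); rewrite /= !odd_double.
- move=> [] /double_inj /iinj e; congr inr; apply: val_inj; apply: e; exact: valP.
Qed.

Lemma aleph_separable_dense (T : topologicalType) (K : aleph) :
  aleph_separable T K -> exists2 D : set T, dense D & D #< [set: K].
Proof.
move=> [D [dD _] [DK KD]]; exists D => //.
have Dle : D #<= [set: nat + set_type D].
  rewrite -(card_le_eql (card_setT D)).
  by apply: (@inj_card_leP _ _ _ _ inr) => // x y _ _ [].
split; first exact: card_le_trans DK.
by move=> KD'; apply: KD; exact: card_le_trans Dle.
Qed.

(** * Uniformly dense sets of continuous functions *)

Section uniformly_dense.
Context (R : realType) (X : topologicalType).
Implicit Types (f g h : continuousType X R) (D M : set (continuousType X R)).

(** A strict pointwise bound by s gives membership in [sup_ball] at every radius above s; as [e] is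
    arbitrary, this is density for uniform convergence. *)
Definition uniformly_dense D := forall f (e : R), 0 < e ->
  exists2 g, D g & forall x, `|f x - g x| < e.

Lemma sup_ball_lt f g A (e : R) x : sup_ball f A e g -> A x -> `|f x - g x| < e.
Proof. by move=> /sup_ballP[s se fg] Ax; exact: le_lt_trans (fg x Ax) se. Qed.

Lemma lt_sup_ball f g A (s e : R) : s < e -> (forall x, `|f x - g x| < s) ->
  sup_ball f A e g.
Proof. by move=> se fg; apply/sup_ballP; exists s => // x _; exact: ltW. Qed.

Lemma separable_C_unifP :
  separable (C_unif R X) <-> exists2 D, countable D & uniformly_dense D.
Proof.
split=> -[D cD dD]; exists D => //.
  move=> f e e0.
  have : nbhs (f : C_unif R X) (sup_ball f setT e) by rewrite nbhs_C_unif; exists e.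
  rewrite nbhsE => -[U [oU Uf] UB].
  have [g [Ug Dg]] := dD U (ex_intro _ f Uf) oU.
  by exists g => // x; exact: sup_ball_lt (UB _ Ug) _.
move=> O [f Of] oO.
have : nbhs (f : C_unif R X) O by exact: open_nbhs_nbhs.
rewrite nbhs_C_unif => -[e /= e0 eO].
have [g Dg fg] : exists2 g, D g & forall x, `|f x - g x| < e / 2.
  by apply: dD; rewrite divr_gt0.
by exists g; split=> //; apply: eO; apply: lt_sup_ball fg; lra.
Qed.

Lemma dist_continuous f g : continuous (fun x => `|f x - g x|).
Proof.
move=> x; apply: cvg_norm; apply: cvgB; exact: cts_fun.
Qed.

(** If |f - g| exceeds s at one point, it does so on an open set, which meets [A]. *)
Lemma sup_ball_dense f A (e : R) : dense A -> sup_ball f A e = sup_ball f setT e.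
Proof.
move=> dA; apply/seteqP; split=> g /sup_ballP[s se fg]; apply/sup_ballP;
  exists s => // x _; last exact: fg.
rewrite leNgt; apply/negP => sx.
have oO : open ((fun x => `|f x - g x|) @^-1` [set r : R | s < r]).
  by apply: open_comp; [move=> y _; exact: dist_continuous|exact: open_gt].
have [y [/= sy Ay]] := dA _ (ex_intro _ x sx) oO.
by have := fg _ Ay; rewrite leNgt sy.
Qed.

(** Uniting the nets of radius 1/(n+1) allows later arguments to work at one fixed radius. *)
Lemma countable_nets_uniformly_dense :
  (forall e : R, 0 < e -> exists2 M : set (continuousType X R), countable M &
     forall f, exists2 g : continuousType X R, M g & forall x, `|f x - g x| < e) ->
  exists2 D, countable D & uniformly_dense D.
Proof.
move=> nets.
have /choice[M MP] : forall n : nat, exists M : set (continuousType X R), countable M /\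
    forall f, exists2 g : continuousType X R, M g & forall x, `|f x - g x| < n.+1%:R^-1.
  by move=> n; have [//|M cM MP] := nets n.+1%:R^-1; exists M.
exists (\bigcup_n M n); first by apply: bigcup_countable => // n _; have [] := MP n.
move=> f e e0; have [n] := ltr_add_invr e0; rewrite add0r => ne.
have [_ /(_ f)[g Mg fg]] := MP n; exists g; first by exists n.
by move=> x; exact: lt_trans (fg x) ne.
Qed.

Definition separated (e : R) M :=
  forall f g, M f -> M g -> f <> g -> exists x, e <= `|f x - g x|.

(** Zorn's lemma gives a maximal separated set; a function that is not within [e] of any of its
    members could be added to it. *)
Lemma ex_separated_net (e : R) : 0 < e ->
  exists2 M : set (continuousType X R), separated e M &
  forall f, exists2 g : continuousType X R, M g & forall x, `|f x - g x| < e.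
Proof.
move=> e0; have [F FP Ftot|M [Msep Mmax]] := @Zorn_bigcup _ (separated e).
  move=> f g [A FA Af] [B FB Bg].
  have [AB|BA] := Ftot _ _ FA FB.
    by apply: (FP _ FB) => //; exact: AB.
  by apply: (FP _ FA) => //; exact: BA.
exists M => // f; apply: contrapT => nf.
have far g : M g -> exists x, e <= `|f x - g x|.
  move=> Mg; apply: contrapT => /forallNP fg; apply: nf; exists g => // x.
  by rewrite ltNge; apply/negP/fg.
apply: (Mmax (M `|` [set f])).
  split; first by move=> g Mg; left.
  move=> /(_ f (or_intror erefl))/far[x].
  by rewrite subrr normr0 leNgt e0.
move=> g h [Mg|->] [Mh|->] // gh; first exact: Msep.
  by have [x] := far _ Mg; exists x; rewrite distrC.
exact: far.
Qed.

(* For unbounded [h] the functions [a *: h] are at infinite distance from each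
   other, so a countable uniformly dense set would enumerate the reals. *)
Lemma uniformly_dense_bounded D (h : X -> R) : countable D -> uniformly_dense D ->
  continuous h -> exists m : R, forall x, `|h x| <= m.
Proof.
move=> cD dD hc; apply: contrapT => hunb.
have unb m : exists x, m < `|h x|.
  apply: contrapT => /forallNP hm; apply: hunb; exists m => x.
  by rewrite leNgt; apply/negP/hm.
have ahc a : continuous (fun x => a * h x).
  by move=> x; apply: cvgM; [exact: cvg_cst|exact: hc].
have /choice[c cP] : forall a : R, exists g : continuousType X R,
    D g /\ forall x, `|a * h x - g x| < 1.
  by move=> a; have [//|g Dg ag] := dD (mkcts (ahc a)) 1; exists g.
have cR : countable [set: R].
  apply: sub_countable cD; apply: (@inj_card_leP _ _ _ _ c) => [a _|a b _ _ cab].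
    by have [] := cP a.
  apply/eqP; rewrite -subr_eq0; apply/negPn/negP => ab0.
  have abpos : 0 < `|a - b| by rewrite normr_gt0.
  (* One function within 1 of both [a * h] and [b * h] forces |a - b| |h x| < 2 at every x; the
     point chosen here violates this. *)
  have [x] := unb (2 / `|a - b|); rewrite ltr_pdivrMr// -normrM mulrBr => xab.
  have [_ /(_ x) ha] := cP a; have [_ /(_ x)] := cP b; rewrite -cab => hb.
  have := ler_distD (c a x) (a * h x) (b * h x).
  rewrite [ `|c a x - _|]distrC leNgt => /negP; apply.
  by rewrite (mulrC a) (mulrC b); move: ha hb xab; rewrite (mulrC a) (mulrC b); lra.
(* The reals are uncountable: countable sets have measure zero, but [0, 1] has measure one. *)
have := countable_lebesgue_measure0
  (sub_countable (subset_card_le (@subsetT _ `[0, 1])) cR).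
by rewrite lebesgue_measure_itv/= lte01 sube0 => /eqP; rewrite onee_eq0.
Qed.

End uniformly_dense.

(** * Uniformly dense sets obtained from properties of [C_aleph] *)

Section C_aleph_properties.
Context (K : aleph) (R : realType) (X : topologicalType).
Implicit Types (A : set X).

Lemma C_aleph_separable_uniformly_dense : [set: nat] #< [set: K] ->
  separable (C_aleph K R X) ->
  exists2 D : set (continuousType X R), countable D & uniformly_dense D.
Proof.
move=> NK [D cD dD]; exists D => // f e e0; apply: contrapT => nf.
have far g : D g -> exists x, e <= `|f x - g x|.
  move=> Dg; apply: contrapT => /forallNP fg; apply: nf; exists g => // x.
  by rewrite ltNge; apply/negP/fg.
(* Density in the whole space provides a member of [D], hence a point [x0] of [X], the default in
   the choice of [p]. *)
have [g0 [_ /far[x0 _]]] := dD setT (ex_intro _ f I) openT.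
have /choice[p pP] : forall g, exists x, D g -> e <= `|f x - g x|.
  move=> g; have [/far[x fgx]|nDg] := pselect (D g); first by exists x.
  by exists x0.
have pK : p @` D #< [set: K].
  by apply: countable_card_lt => //; exact: sub_countable (card_image_le _ _) cD.
have oB : open (sup_ball f (p @` D) e : set (C_aleph K R X)).
  by apply: (@C_aleph_basis K R X).1; exists f, (p @` D), e.
have [g [fg Dg]] := dD _ (ex_intro _ f (sup_ball_center f (p @` D) e0)) oB.
have := pP g Dg; rewrite leNgt => /negP; apply.
by apply: sup_ball_lt fg _; exists g.
Qed.

Lemma uniformly_dense_second_countable A (D : set (continuousType X R)) :
  dense A -> A #< [set: K] -> countable D -> uniformly_dense D ->
  @second_countable (C_aleph K R X).
Proof.
move=> dA AK cD dD.
pose b (p : continuousType X R * nat) : set (C_aleph K R X) :=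
  sup_ball p.1 A p.2.+1%:R^-1.
exists (b @` (D `*` setT)).
  by apply: sub_countable (card_image_le _ _) _; exact: countableX.
split.
  move=> _ [[g n] _ <-]; apply: (@C_aleph_basis K R X).1.
  by exists g, A, n.+1%:R^-1; split.
move=> f P /(C_aleph_basis K R X).2[_ [[f0 [A0 [e [AK0 e0 ->]]]] f0f] f0P].
have [d d0 dP] := sup_ball_sub f0f.
(* The radius r = 1/(n+1) is below d/2 and [g] is taken within r/2 of [f]: then [f] lies in the ball
   of radius r around [g], and every member of that ball is within 3r/2 < d of [f]. *)
have [n] := ltr_add_invr (divr_gt0 d0 (ltr0Sn R 1)); rewrite add0r => nd.
have n0 : 0 < n.+1%:R^-1 / 2 :> R by rewrite divr_gt0.
have [g Dg fg] := dD f _ n0.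
exists (b (g, n)).
  split; first by exists (g, n).
  rewrite /b/=; apply: (@lt_sup_ball _ _ _ _ _ (n.+1%:R^-1 / 2)).
    by move: n0; set r := n.+1%:R^-1; lra.
  by move=> x; rewrite distrC.
rewrite /b/= sup_ball_dense// => h /sup_ballP[s sn gh].
apply: f0P; apply: (dP setT (@subsetT _ _)); apply/sup_ballP.
exists (n.+1%:R^-1 / 2 + s); first by move: nd sn; set r := _^-1; lra.
move=> x _; apply: (le_trans (ler_distD (g x) _ _)); apply: lerD; last exact: gh.
exact/ltW/fg.
Qed.

Lemma sup_ball_open A f (e : R) : dense A -> A #< [set: K] -> 0 < e ->
  open (sup_ball f setT e : set (C_aleph K R X)).
Proof.
move=> dA AK e0; rewrite -(sup_ball_dense f e dA).
by apply: (@C_aleph_basis K R X).1; exists f, A, e.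
Qed.

(** The uniform balls of radius [e] are open because [A] is dense and small; the centres of a
    countable subcover form a net. *)
Lemma lindelof_uniformly_dense A : dense A -> A #< [set: K] ->
  lindelof (C_aleph K R X) ->
  exists2 D : set (continuousType X R), countable D & uniformly_dense D.
Proof.
move=> dA AK lin; apply: countable_nets_uniformly_dense => e e0.
pose b (f : continuousType X R) : set (C_aleph K R X) := sup_ball f setT e.
have [||G [GF cG Gc]] := lin (range b).
- by move=> _ [f _ <-]; exact: sup_ball_open dA AK e0.
- apply/seteqP; split=> // f _; exists (b f); first by exists f.
  exact: sup_ball_center.
have /choice[c cP] : forall B, exists f : continuousType X R, G B -> B = b f.
  move=> B; have [GB|nGB] := pselect (G B); last by exists (cst 0).
  by have [f _ <-] := GF _ GB; exists f.
exists (c @` G); first exact: sub_countable (card_image_le _ _) cG.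
move=> f; have : [set: C_aleph K R X] f by [].
rewrite -Gc => -[B GB Bf]; exists (c B); first by exists B.
have cBf : b (c B) f by rewrite -(cP _ GB).
by move=> x; rewrite distrC; exact: sup_ball_lt cBf _.
Qed.

Lemma souslin_uniformly_dense A : dense A -> A #< [set: K] ->
  souslin_property (C_aleph K R X) ->
  exists2 D : set (continuousType X R), countable D & uniformly_dense D.
Proof.
move=> dA AK sou; apply: countable_nets_uniformly_dense => e e0.
have [M Msep Mnet] := @ex_separated_net R X e e0; exists M => //.
have e20 : 0 < e / 2 by rewrite divr_gt0.
pose b (f : continuousType X R) : set (C_aleph K R X) := sup_ball f setT (e / 2).
have bdisj f g h : M f -> M g -> b f h -> b g h -> f = g.
  move=> Mf Mg fh gh; apply: contrapT => /(Msep _ _ Mf Mg)[x].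
  rewrite leNgt => /negP; apply.
  rewrite (le_lt_trans (ler_distD (h x) _ _))// [X in _ < X](splitr e).
  by rewrite ltrD// ?[ `|h x - _|]distrC;
    [exact: sup_ball_lt fh _|exact: sup_ball_lt gh _].
have cbM : countable (b @` M).
  apply: sou => [_ [f Mf <-]|_ _ [f Mf <-] [g Mg <-] fg].
    by split; [exact: sup_ball_open dA AK e20|exists f; exact: sup_ball_center].
  rewrite -subset0 => h [fh gh]; apply: fg.
  by rewrite (bdisj _ _ _ Mf Mg fh gh).
apply: sub_countable cbM; apply: (@inj_card_leP _ _ _ _ b) => [f Mf|f g Mf Mg bfg].
  by exists f.
by apply: (bdisj _ _ f) => //; rewrite -?bfg; exact: sup_ball_center.
Qed.

Lemma spread_uniformly_dense A : dense A -> A #< [set: K] ->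
  countable_spread (C_aleph K R X) ->
  exists2 D : set (continuousType X R), countable D & uniformly_dense D.
Proof.
move=> dA AK spr; apply: countable_nets_uniformly_dense => e e0.
have [M Msep Mnet] := @ex_separated_net R X e e0; exists M => //.
apply: (spr M) => B.
(* A ball of radius [e] around a member of [M] contains no other member, so the trace of this union
   on [M] is exactly [B]. *)
exists (\bigcup_(f in val @` B) sup_ball f setT e : set (C_aleph K R X)).
  by apply: bigcup_open => f _; exact: sup_ball_open dA AK e0.
apply/seteqP; split=> [g [_ [f Bf <-]] fg|g Bg]; last first.
  by exists (val g); [exists g|exact: sup_ball_center].
suff -> : g = f by [].
apply: val_inj; apply: contrapT => gf.
have [x] := Msep _ _ (set_valP g) (set_valP f) gf.
by rewrite leNgt distrC => /negP; apply; exact: sup_ball_lt fg _.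
Qed.

End C_aleph_properties.

(** * Open covers and finite intersections of neighbourhoods *)

Lemma compact_coverT (X : topologicalType) :
  compact [set: X] <-> cover_compact [set: X].
Proof.
have [[x0 _]|X0] := pselect (exists x : X, True).
  pose P : ptopologicalType := HB.pack X (isPointed.Build X x0).
  by change (@compact P setT <-> @cover_compact P setT); rewrite compact_cover.
split=> _.
  by move=> I D f _ _; exists fset0%fset => // x; exfalso; apply: X0; exists x.
move=> F PF FT; have [x _] := filter_ex FT.
by exfalso; apply: X0; exists x.
Qed.

Lemma near_forall_lt (X : topologicalType) (x : X) (P : nat -> X -> Prop) (N : nat) :
  (forall n, \forall y \near x, P n y) ->
  \forall y \near x, forall n, (n < N)%N -> P n y.
Proof.
move=> nP; elim: N => [|N IH]; first exact: nearW.
near=> y => n; rewrite ltnS leq_eqVlt => /orP[/eqP->|].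
  by near: y; exact: nP.
by move: n; near: y.
Unshelve. all: by end_near. Qed.

(** * Capped suprema of sequences *)

Section capped_sup.
Context (R : realType).
Implicit Types (a b c : nat -> R).

(* Capping the n-th term at 1/(n+1) makes the supremum behave like a uniformly
   convergent series: up to any positive error it depends on finitely many terms. *)
Definition capped_sup a : R := sup (range (fun n => Num.min n.+1%:R^-1 (a n))).

Lemma capped_sup_le a (e : R) : (forall n, Num.min n.+1%:R^-1 (a n) <= e) ->
  capped_sup a <= e.
Proof.
move=> ae; apply: ge_sup; first by exists (Num.min 1%:R^-1 (a 0%N)), 0%N.
by move=> _ [n _ <-].
Qed.

Lemma le_capped_sup a n : Num.min n.+1%:R^-1 (a n) <= capped_sup a.
Proof.
apply: ub_le_sup; last by exists n.
exists 1 => _ [m _ <-]; rewrite ge_min; apply/orP; left.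
by rewrite invf_le1// ler1n.
Qed.

Lemma capped_sup_ge0 a : (forall n, 0 <= a n) -> 0 <= capped_sup a.
Proof.
by move=> a0; apply: le_trans (le_capped_sup a 0); rewrite le_min a0 invr_ge0 ler0n.
Qed.

Lemma capped_sup_gt0 a n : 0 < a n -> 0 < capped_sup a.
Proof.
move=> an0; apply: lt_le_trans (le_capped_sup a n).
by rewrite lt_min an0 invr_gt0 ltr0Sn.
Qed.

(** Capping at a non-negative constant is subadditive on non-negative reals. This gives the triangle
    inequality for the metric built below. *)
Lemma capped_supD a b c : (forall n, 0 <= a n) -> (forall n, 0 <= b n) ->
  (forall n, c n <= a n + b n) -> capped_sup c <= capped_sup a + capped_sup b.
Proof.
move=> a0 b0 cab; apply: capped_sup_le => n.
apply: le_trans (lerD (le_capped_sup a n) (le_capped_sup b n)).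
have r0 : 0 <= n.+1%:R^-1 :> R by rewrite invr_ge0 ler0n.
move: (a0 n) (b0 n) (cab n) r0; rewrite /Num.min; set r := _^-1.
by case: ltP => ?; case: ltP => ?; case: ltP => ? ? ? ? ?; lra.
Qed.

(** [N] is chosen before [a]: the terms of index at least [N] are at most 1/(N+1) < [e] by their
    caps alone. *)
Lemma capped_sup_small (e : R) : 0 < e -> exists N, forall a,
  (forall n, (n < N)%N -> a n <= e) -> capped_sup a <= e.
Proof.
move=> e0; have [N] := ltr_add_invr e0; rewrite add0r => Ne.
exists N => a aN; apply: capped_sup_le => n; rewrite ge_min.
have [/aN->|Nn] := ltnP n N; first by rewrite orbT.
apply/orP; left; apply: le_trans (ltW Ne).
by rewrite lef_pV2 ?posrE ?ltr0Sn// ler_nat.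
Qed.

Lemma near_capped_sup_dist (X : topologicalType) (g : nat -> X -> R) (x : X) (e : R) :
  (forall n, continuous (g n)) -> 0 < e ->
  \forall y \near x, capped_sup (fun n => `|g n x - g n y|) <= e.
Proof.
move=> gc e0; have [N NP] := capped_sup_small e0.
have : \forall y \near x, forall n, (n < N)%N -> `|g n x - g n y| <= e.
  apply: near_forall_lt => n.
  by have /cvgrPdist_le/(_ e e0) := gc n x.
by apply: filterS => y; exact: NP.
Qed.

Lemma capped_sup_continuous (X : topologicalType) (g : nat -> X -> R) :
  (forall n, continuous (g n)) -> (forall n x, 0 <= g n x) ->
  continuous (fun x => capped_sup (g^~ x)).
Proof.
move=> gc g0 x; apply/cvgrPdist_le => e e0.
apply: filterS (near_capped_sup_dist x gc e0) => y; apply: le_trans.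
(* Subadditivity bounds the variation of the supremum by the capped supremum of the variations,
   which is already small near [x]. *)
have h z t : capped_sup (g^~ z) - capped_sup (g^~ t) <=
    capped_sup (fun n => `|g n z - g n t|).
  rewrite lerBlDr; apply: capped_supD => // n.
  by rewrite -lerBlDr ler_norm.
rewrite ler_norml h andbT lerNl opprB; apply: le_trans (h y x) _.
by under eq_fun do rewrite distrC.
Qed.

End capped_sup.

(** * Compactness and metrizability of [X] *)

Lemma lindelof_pseudocompact_compact (R : realType) (X : topologicalType) :
  completely_regular_space X -> lindelof X ->
  (forall h : X -> R, continuous h -> exists m : R, forall x, `|h x| <= m) ->
  compact [set: X].
Proof.
move=> crX linX bX; apply/compact_coverT => I D f fo fcov.
have [[x0 _]|X0] := pselect (exists x : X, True); last first.
  by exists fset0%fset => // x; exfalso; apply: X0; exists x.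
have [i0 Di0 _] := fcov x0 Logic.I.
(* The index stored with a function names a member of the cover containing its cozero set, so
   finitely many functions yield a finite subcover. *)
pose good (p : (X -> R) * I) := [/\ continuous p.1, forall x, 0 <= p.1 x, D p.2 &
  forall x, 0 < p.1 x -> f p.2 x].
pose F : set (set X) := [set V | exists2 p, good p & V = [set x | 0 < p.1 x]].
have [||G [GF cG Gc]] := linX F.
- move=> _ [p [pc _ _ _] ->].
  by apply: (@open_comp _ _ p.1 [set r | 0 < r]);
    [move=> y _; exact: pc|exact: open_gt].
- apply/seteqP; split=> // x _; have [i Di fix_] := fcov x Logic.I.
  have /(@uniform_separatorP _ R)[g [gc g01 gx gf]] :
      uniform_separator [set x] (~` f i).
    by apply: crX; [exact/open_closedC/fo|apply].
  have gx0 : g x = 0 by apply: gx; exists x.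
  have g01' y : 0 <= g y <= 1.
    by have := g01 (g y) (imageT _ _); rewrite /= in_itv.
  exists [set y | 0 < 1 - g y]; last by rewrite /= gx0 subr0.
  exists ((fun y => 1 - g y), i) => //; split=> //=.
  + by move=> y; apply: cvgB; [exact: cvg_cst|exact: gc].
  + by move=> y; rewrite subr_ge0; have /andP[] := g01' y.
  + move=> y; apply: contraPP => nfy.
    by have -> : g y = 1; [apply: gf; exists y|rewrite subrr ltxx].
have [u uG] := countable_enum setT cG.
have /choice[p pP] : forall n, exists p, good p /\
    (G (u n) -> u n = [set x | 0 < p.1 x]).
  move=> n; have [/[dup] Gu /GF[p gp uE]|nG] := pselect (G (u n)).
    by exists p.
  exists (cst 0, i0); split=> //; split=> //= [|x]; last by rewrite ltxx.
  by move=> x; exact: cvg_cst.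
pose g n := (p n).1; pose S x := capped_sup (g^~ x).
have Sc : continuous S.
  by apply: capped_sup_continuous => n; have [[]] := pP n.
have S0 x : 0 < S x.
  have : [set: X] x by [].
  rewrite -Gc => -[V GV Vx]; have [n _ unV] := uG _ GV.
  apply: (@capped_sup_gt0 _ _ n).
  have [_] := pP n; rewrite unV => /(_ GV) VE.
  by move: Vx; rewrite VE.
have [m mP] : exists m, forall x, `|(S x)^-1| <= m.
  apply: bX => x; apply: cvgV; last exact: Sc.
  by rewrite gt_eqF.
have m0 : 0 < m.
  by apply: lt_le_trans (mP x0); rewrite normr_gt0 invr_eq0 gt_eqF.
have Sm x : m^-1 <= S x.
  rewrite -[leRHS]invrK lef_pV2 ?posrE ?invr_gt0//.
  by apply: le_trans (mP x); exact: ler_norm.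
(* Since [S] is at least 1/m, it never drops to 1/(2m), so at each x some g_n with n < [N] is
   positive: the first [N] cozero sets cover [X]. *)
have m20 : 0 < m^-1 / 2 by rewrite divr_gt0// invr_gt0.
have [N NP] := capped_sup_small m20.
exists [fset (p n).2 | n in iota 0 N]%fset.
  move=> i /imfsetP[n _ ->]; apply/mem_set.
  by have [[]] := pP n.
move=> x _; have [n nN gn0] : exists2 n, (n < N)%N & 0 < g n x.
  apply: contrapT => ng; have /NP : forall n, (n < N)%N -> g n x <= m^-1 / 2.
    move=> n nN; apply: (@le_trans _ _ 0); last by rewrite divr_ge0// invr_ge0 ltW.
    by rewrite leNgt; apply/negP => gn; apply: ng; exists n.
  apply/negP; rewrite -ltNge; apply: lt_le_trans (Sm x).
  by rewrite gtr_pMr ?invr_gt0// invf_lt1// ltr1n.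
exists (p n).2; last by have [[_ _ _ +] _] := pP n; exact.
by apply/imfsetP; exists n => //=; rewrite mem_iota.
Qed.

(** Approximating within 1/2 a function that is 0 at [x] and 1 off [U] gives a value below 1/2 at
    [x] and values above 1/2 off [U]. *)
Lemma uniformly_dense_sublevel (R : realType) (X : topologicalType)
    (D : set (continuousType X R)) (x : X) (U : set X) :
  completely_regular_space X -> uniformly_dense D -> open U -> U x ->
  exists2 g, D g & g x < 2^-1 /\ forall y, g y < 2^-1 -> U y.
Proof.
move=> crX dD oU Ux.
have /(@uniform_separatorP _ R)[f [fc _ fx fU]] : uniform_separator [set x] (~` U).
  by apply: crX; [exact: open_closedC|apply].
have fx0 : f x = 0 by apply: fx; exists x.
have [g Dg fg] : exists2 g, D g & forall y, `|f y - g y| < 2^-1.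
  by apply: (dD (mkcts fc)); rewrite invr_gt0.
exists g => //; split=> [|y].
  have := fg x; rewrite fx0 sub0r normrN; apply: le_lt_trans.
  exact: ler_norm.
apply: contraPP => nUy; have := fg y.
have -> : f y = 1 by apply: fU; exists y.
by move=> /(le_lt_trans (ler_norm _)) h1 h2; move: h1 h2; lra.
Qed.

Lemma uniformly_dense_domain_second_countable (R : realType) (X : topologicalType)
    (D : set (continuousType X R)) :
  completely_regular_space X -> countable D -> uniformly_dense D ->
  @second_countable X.
Proof.
move=> crX cD dD.
pose V (g : continuousType X R) : set X := g @^-1` [set r | r < 2^-1].
exists (V @` D); first exact: sub_countable (card_image_le _ _) cD.
split=> [_ [g _ <-]|x P].
  by apply: open_comp; [move=> y _; exact: cts_fun|exact: open_lt].
rewrite nbhsE => -[U [oU Ux] UP].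
have [g Dg [gx gU]] := uniformly_dense_sublevel crX dD oU Ux.
by exists (V g); [split=> //; exists g|move=> y /gU/UP].
Qed.

Lemma uniformly_dense_metrizable (R : realType) (X : topologicalType)
    (D : set (continuousType X R)) :
  tychonoff_space X -> countable D -> uniformly_dense D -> metrizable X R.
Proof.
move=> [crX hX] cD dD.
have [u Du] := countable_enum (cst 0 : continuousType X R) cD.
pose diff x y n := `|u n x - u n y|.
have diff0 x y n : 0 <= diff x y n by exact: normr_ge0.
have sep x U : open U -> U x -> exists2 e : R, 0 < e &
    forall y, capped_sup (diff x y) < e -> U y.
  move=> oU Ux; have [_ /Du[n _ <-] [ux uU]] := uniformly_dense_sublevel crX dD oU Ux.
  have r0 : 0 < n.+1%:R^-1 :> R by [].
  (* Below the cap 1/(n+1) the n-th term is |u_n x - u_n y| itself; keeping it below 1/2 - u_n x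
     keeps u_n y below 1/2. *)
  exists (Num.min n.+1%:R^-1 (2^-1 - u n x)); first by rewrite lt_min r0 subr_gt0.
  move=> y /(le_lt_trans (le_capped_sup _ n)); rewrite lt_min gt_min ltxx/=.
  move=> /andP[dr]; rewrite gt_min => rdx; apply: uU.
  have dx : diff x y n < 2^-1 - u n x by case/orP: rdx => // /(lt_trans dr).
  have := ler_norm (u n y - u n x); rewrite distrC; move: dx; rewrite /diff.
  by lra.
exists (fun x y => capped_sup (diff x y)); split.
- by move=> x y; exact: capped_sup_ge0.
- move=> x y; split=> [dxy|->]; last first.
    apply/eqP; rewrite eq_le capped_sup_ge0// andbT; apply: capped_sup_le => n.
    by rewrite /diff subrr normr0 ge_min lexx orbT.
  apply: hX => A B; rewrite nbhsE => -[U [oU Ux] UA] /nbhs_singleton By.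
  exists y; split => //; apply: UA.
  by have [e e0] := sep x U oU Ux; apply; rewrite dxy.
- move=> x y; congr (capped_sup _); apply/funext => n; exact: distrC.
- by move=> x y z; apply: capped_supD => // n; exact: ler_distD.
- move=> x; apply/seteqP; split=> P.
    rewrite nbhsE => -[U [oU Ux] UP]; have [e e0 eU] := sep x U oU Ux.
    by exists e => // y /eU/UP.
  move=> [e /= e0 eP].
  have e20 : 0 < e / 2 by rewrite divr_gt0.
  have := near_capped_sup_dist x (fun n => @cts_fun _ _ (u n)) e20.
  apply: filterS => y dxy; apply: eP => /=; apply: le_lt_trans dxy _.
  by rewrite gtr_pMr// invf_lt1// ltr1n.
Qed.

(** * Countable uniformly dense sets on compact metrizable spaces *)

Lemma compact_metrizable_second_countable (R : realType) (X : topologicalType) :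
  compact [set: X] -> metrizable X R -> @second_countable X.
Proof.
move=> /compact_coverT cX [d [d0 dP dC dT dN]].
have nbhs_d x (e : R) : 0 < e -> nbhs x [set y | d x y < e].
  by move=> e0; rewrite dN; exists e.
(* Interiors supply open sets directly: [metrizable] describes balls only as neighbourhoods of their
   centres. *)
pose f n x : set X := ([set y | d x y < n.+1%:R^-1])°.
have h n : finite_subset_cover [set: X] (f n) [set: X].
  apply: cX => [x _|x _]; first exact: open_interior.
  by exists x => //; exact: nbhs_d.
have /choice[F FP] : forall n, exists F : {fset X},
    [set: X] `<=` cover [set` F] (f n).
  by move=> n; have [F _ FP] := h n; exists F.
exists (\bigcup_n f n @` [set` F n]).
  apply: bigcup_countable => // n _; apply: finite_set_countable.
  exact/finite_image/finite_fset.
split=> [_ [n _ [x _ <-]]|x P]; first exact: open_interior.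
rewrite {1}dN => -[e /= e0 eP].
have [n] := ltr_add_invr (divr_gt0 e0 (ltr0Sn R 1)); rewrite add0r => ne.
have [z zF fz] := FP n x Logic.I.
exists (f n z); first by split => //; exists n => //; exists z.
move=> y fy; apply: eP => /=.
apply: le_lt_trans (dT x z y) _; rewrite dC [ltRHS]splitr.
by apply: ltrD; apply: lt_trans ne;
  [exact: (interior_subset fz)|exact: (interior_subset fy)].
Qed.

(* A code is a finite list of basic open sets with rational values; it selects
   some function that is nearly constant with these values, if there is one. *)
Lemma compact_second_countable_uniformly_dense (R : realType) (X : topologicalType) :
  compact [set: X] -> @second_countable X ->
  exists2 D : set (continuousType X R), countable D & uniformly_dense D.
Proof.
move=> /compact_coverT cX [B cB Bb].
apply: countable_nets_uniformly_dense => e e0.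
have [b Bb'] := countable_enum setT cB.
pose spec (c : seq (nat * rat)) (f : X -> R) := forall p, p \in c ->
  forall y, b p.1 y -> `|f y - ratr p.2| < e / 2.
have /choice[s sP] : forall c, exists g : continuousType X R,
    (exists f : continuousType X R, spec c f) -> spec c g.
  move=> c; have [[f cf]|nf] := pselect (exists f : continuousType X R, spec c f).
    by exists f.
  by exists (cst 0).
exists (range s).
  by apply: sub_countable (card_image_le _ _) _; exact: countableP.
move=> f.
(* An oscillation below e/4 and a rational error below e/4 give the e/2 of [spec]; two functions
   meeting a code whose sets cover [X] are then within [e] of each other. *)
have e40 : 0 < e / 4 by rewrite divr_gt0.
have /choice[k kP] : forall x, exists n, [/\ open (b n), b n x &
    forall y, b n y -> `|f x - f y| < e / 4].
  move=> x; pose U := (fun y => `|f x - f y|) @^-1` [set r | r < e / 4].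
  have oU : open U.
    apply: open_comp; last exact: open_lt.
    move=> y _; apply: cvg_norm; apply: cvgB; [exact: cvg_cst|exact: cts_fun].
  have Ux : U x by rewrite /U/= subrr normr0.
  have [V [BV Vx VU]] := open_basis_sub Bb oU Ux.
  have [n _ nV] := Bb' _ BV; exists n; rewrite nV; split => //.
  exact: Bb.1.
have /choice[q qP] : forall x, exists r : rat, `|f x - ratr r| < e / 4.
  move=> x; have [r] : exists r, ratr r \in `]f x - e / 4, f x + e / 4[.
    by apply: rat_in_itvoo; move: e40; lra.
  by rewrite in_itv/= => rP; exists r; rewrite distrC ltr_distl.
have [F _ FX] : finite_subset_cover [set: X] (b \o k) [set: X].
  by apply: cX => x _; [have [] := kP x|exists x => //; have [] := kP x].
pose c := [seq (k x, q x) | x <- F].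
have fc : spec c f.
  move=> _ /mapP[x _ ->] y /= ky; have [_ _ /(_ _ ky) xy] := kP x.
  have := ler_distD (f x) (f y) (ratr (q x)).
  by move: xy (qP x); rewrite [ `|f x - f y|]distrC; lra.
exists (s c); first by exists c.
move=> y; have [x xF kxy] := FX y Logic.I.
have pc : (k x, q x) \in c by apply/mapP; exists x.
have := fc _ pc y kxy; have := sP c (ex_intro _ f fc) _ pc y kxy => /= sq fq.
have := ler_distD (ratr (q x)) (f y) (s c y).
by move: sq fq; rewrite [ `|s c y - _|]distrC; lra.
Qed.

(** * The cycle of implications *)

Lemma uniformly_dense_compact_metrizable (R : realType) (X : topologicalType)
    (D : set (continuousType X R)) :
  tychonoff_space X -> countable D -> uniformly_dense D ->
  compact [set: X] /\ metrizable X R.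
Proof.
move=> tX cD dD; split; last exact: uniformly_dense_metrizable cD dD.
apply: (@lindelof_pseudocompact_compact R); first exact: tX.1.
  apply: second_countable_lindelof.
  exact: uniformly_dense_domain_second_countable tX.1 cD dD.
by move=> h; exact: uniformly_dense_bounded cD dD.
Qed.

Lemma compact_metrizable_C_aleph (K : aleph) (R : realType) (X : topologicalType) :
  [set: nat] #< [set: K] -> compact [set: X] -> metrizable X R ->
  @second_countable (C_aleph K R X) /\ aleph_separable X K.
Proof.
move=> NK cX mX; have scX := compact_metrizable_second_countable cX mX.
have sX := second_countable_separable scX.
split; last exact: separable_aleph_separable.
have [A cA dA] := sX.
have [D cD dD] := compact_second_countable_uniformly_dense R cX scX.
exact: uniformly_dense_second_countable dA (countable_card_lt NK cA) cD dD.
Qed.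

Theorem theorem5p36 (R : realType) (X : topologicalType) (K : aleph)
    (X_tychonoff : tychonoff_space X) (K_ge_aleph1 : [set: nat] #< [set: K]) :
  [<-> @second_countable (C_aleph K R X);
       separable (C_aleph K R X);
       lindelof (C_aleph K R X) /\ aleph_separable X K;
       souslin_property (C_aleph K R X) /\ aleph_separable X K;
       countable_spread (C_aleph K R X) /\ aleph_separable X K;
       separable (C_unif R X);
       compact [set: X] /\ metrizable X R].
Proof.
(* Within the cycle a property first yields a countable uniformly dense set; the passage through
   compact metrizable [X] returns second countability, which implies the next property. *)
have C_aleph_of (D : set (continuousType X R)) : countable D ->
    uniformly_dense D ->
    @second_countable (C_aleph K R X) /\ aleph_separable X K.
  move=> cD dD.
  have [cX mX] := uniformly_dense_compact_metrizable X_tychonoff cD dD.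
  exact: compact_metrizable_C_aleph cX mX.
tfae.
- exact: second_countable_separable.
- move=> /(C_aleph_separable_uniformly_dense K_ge_aleph1)[D cD dD].
  have [scC sX] := C_aleph_of D cD dD.
  by split=> //; exact: second_countable_lindelof.
- move=> [linC sX]; have [A dA AK] := aleph_separable_dense sX.
  have [D cD dD] := lindelof_uniformly_dense dA AK linC.
  by split=> //; apply: second_countable_souslin; have [] := C_aleph_of D cD dD.
- move=> [souC sX]; have [A dA AK] := aleph_separable_dense sX.
  have [D cD dD] := souslin_uniformly_dense dA AK souC.
  by split=> //; apply: second_countable_spread; have [] := C_aleph_of D cD dD.
- move=> [sprC sX]; have [A dA AK] := aleph_separable_dense sX.
  exact/separable_C_unifP/(spread_uniformly_dense dA AK sprC).
- move=> /separable_C_unifP[D cD dD].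
  exact: uniformly_dense_compact_metrizable cD dD.
- by move=> [cX mX]; have [] := compact_metrizable_C_aleph K_ge_aleph1 cX mX.
Qed.
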